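(* Let $k$ be fixed, let $N=N(n)$, and let $(P_n)_{n\in\mathbb N}$ be a sequence of orthogonal projections $P_n\in M_k\otimes M_n$ of rank $N$, with $P_n=V_nV_n^*$ for isometries $V_n:\mathbb C^N\to\mathbb C^k\otimes\mathbb C^n$, and let $\Phi_n(X)=(\mathrm{id}_k\otimes\mathrm{Tr}_n)(V_nXV_n^* )$. Suppose $(P_n)$ satisfies condition $\mathcal C_m$ with $m=(2k^2-3)k^2+1$ and limiting function $f$. Let $K=\{B\in D_k:\mathrm{Tr}[BA]\le f(A)\ \forall A\in D_k\}$ and let $L_n=\Phi_n(D_N^p)$ be the image under $\Phi_n$ of the set $D_N^p$ of pure states (rank-one projections) in $M_N$. Then $$K^\circ\subseteq\liminf_{n\to\infty}L_n\subseteq\limsup_{n\to\infty}L_n\subseteq K.$$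
   Context: $D_d=\{A\in M_d(\mathbb C):A\ge0,\ \mathrm{Tr}A=1\}$. Condition $\mathcal C_m$: for every $A\in D_k$, the $m$ largest eigenvalues of $P_n(A\otimes I_n)P_n$ converge as $n\to\infty$ to a common limit $f(A)$. For sets, $\liminf_n S_n=\bigcup_{N}\bigcap_{n\ge N}S_n$ and $\limsup_n S_n=\bigcap_N\bigcup_{n\ge N}S_n$. $K^\circ$ denotes the interior of $K$ relative to the affine space of trace-one Hermitian $k\times k$ matrices. *)

(* Defs.v *)
From HB Require Import structures.
From mathcomp Require Import all_boot all_order all_algebra.
From mathcomp Require Import complex mxtens.
From mathcomp Require Import all_classical all_reals all_analysis.
Import numFieldNormedType.Exports.
Set Implicit Arguments. Unset Strict Implicit. Unset Printing Implicit Defensive.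
Import Order.TTheory GRing.Theory Num.Theory.
Local Open Scope ring_scope.
Local Open Scope complex_scope.
Local Open Scope classical_set_scope.

Section Defs.
Variable R : realType.
Local Notation C := (R[i]).

Definition adjmx m n (A : 'M[C]_(m, n)) : 'M[C]_(n, m) := (map_mx Num.conj A)^T.

Definition hermitian n (A : 'M[C]_n) : Prop := adjmx A = A.

Definition psd n (A : 'M[C]_n) : Prop :=
  forall v : 'cV[C]_n, 0 <= (adjmx v *m A *m v) 0 0.

Definition density d : set 'M[C]_d := [set A | psd A /\ \tr A = 1].

Definition pure_states d : set 'M[C]_d :=
  [set P | adjmx P = P /\ P *m P = P /\ \rank P = 1%N].

Definition is_sorted_eigs n (A : 'M[C]_n) (s : seq R) : Prop :=
  sorted (fun x y : R => y <= x) s /\ size s = n /\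
  char_poly A = \prod_(x <- s) ('X - (x%:C)%:P).

Definition eigs n (A : 'M[C]_n) : seq R := xget [::] (is_sorted_eigs A).

(* j-th largest eigenvalue (j = 0 : the largest) *)
Definition eigval n (A : 'M[C]_n) (j : nat) : R := nth 0 (eigs A) j.

Definition ptrace2 k n (Y : 'M[C]_(k * n)) : 'M[C]_k :=
  \matrix_(i, j) \sum_(l < n) Y (mxtens_index (i, l)) (mxtens_index (j, l)).

Definition cond_C k (P : forall n, 'M[C]_(k * n)) (m : nat) (f : 'M[C]_k -> R) :=
  forall A, @density k A -> forall j, (j < m)%N ->
    (fun n => eigval (P n *m (A *t (1%:M : 'M[C]_n)) *m P n) j) @ \oo --> f A.

Definition set_liminf T (S : nat -> set T) : set T :=
  \bigcup_(N0 in [set: nat]) \bigcap_(n in [set n | (N0 <= n)%N]) S n.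
Definition set_limsup T (S : nat -> set T) : set T :=
  \bigcap_(N0 in [set: nat]) \bigcup_(n in [set n | (N0 <= n)%N]) S n.

Definition rel_interior k (K : set 'M[C]_k) : set 'M[C]_k :=
  [set B | K B /\ exists eps : R, 0 < eps /\
     forall B' : 'M[C]_k, hermitian B' -> \tr B' = 1 ->
       (forall i j, `|B' i j - B i j| < eps%:C) -> K B'].
End Defs.
Arguments density {R} d.
Arguments pure_states {R} d.

(* Main.v *)
Require Import Defs.
From HB Require Import structures.
From mathcomp Require Import all_boot all_order all_algebra.
From mathcomp Require Import complex mxtens.
From mathcomp Require Import all_classical all_reals all_analysis.
From mathcomp Require Import ring lra.
Import numFieldNormedType.Exports.
Set Implicit Arguments. Unset Strict Implicit. Unset Printing Implicit Defensive.
Import Order.TTheory GRing.Theory Num.Theory.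
Local Open Scope ring_scope.
Local Open Scope complex_scope.
Local Open Scope classical_set_scope.

(** Only the [k ^ 2 + 1] largest eigenvalues are needed. Write [Phi |u><v|] for the
    partial trace of [V_n u (V_n v)^*]. For [B] in the interior of [K], let the
    unit vector [x] minimise the distance from [Phi |x><x|] to [B]. If it is
    positive, let [H] be the unit vector from [Phi |x><x|] towards [B] and let
    [A = (1 + tau H) / k]. Since [B + e H] lies in [K], the limit [f A] exceeds
    [tr (B A)] by a definite amount, and the span of the eigenvectors for the
    [k ^ 2 + 1] largest eigenvalues of the compression of [A (x) 1] is large enough
    to contain some [w] with [Phi |w><x| = 0], which is [k ^ 2] linear conditions.
    Without cross terms, [Phi] of the projector on [x + t w] is
    [Phi |x><x| + t ^ 2 Phi |w><w|]; normalised, it is closer to [B] than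
    [Phi |x><x|] for small [t], a contradiction. Compactness of the set of
    directions [H] makes the choice of [n] uniform. The inclusion in [K] is the
    variational bound by the largest eigenvalue. *)

(** * Conjugate transposes and a real inner product on complex matrices *)

Section Adjoint.
Variable R : realType.
Local Notation C := (R[i]).

Lemma adjmxE m n (A : 'M[C]_(m, n)) i j : adjmx A i j = Num.conj (A j i).
Proof. by rewrite !mxE. Qed.

Lemma adjmxK m n (A : 'M[C]_(m, n)) : adjmx (adjmx A) = A.
Proof. by apply/matrixP => i j; rewrite !adjmxE conjCK. Qed.

Lemma adjmxM m n p (A : 'M[C]_(m, n)) (B : 'M[C]_(n, p)) :
  adjmx (A *m B) = adjmx B *m adjmx A.
Proof. by rewrite /adjmx map_mxM trmx_mul. Qed.

Lemma adjmxD m n (A B : 'M[C]_(m, n)) : adjmx (A + B) = adjmx A + adjmx B.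
Proof. by rewrite /adjmx map_mxD linearD. Qed.

Lemma adjmxN m n (A : 'M[C]_(m, n)) : adjmx (- A) = - adjmx A.
Proof. by rewrite /adjmx map_mxN linearN. Qed.

Lemma adjmxZ m n (a : C) (A : 'M[C]_(m, n)) : adjmx (a *: A) = Num.conj a *: adjmx A.
Proof. by rewrite /adjmx map_mxZ linearZ. Qed.

Lemma adjmx1 n : adjmx (1%:M : 'M[C]_n) = 1%:M.
Proof. by rewrite /adjmx map_mx1 trmx1. Qed.

Lemma mxtrace_adj n (A : 'M[C]_n) : \tr (adjmx A) = Num.conj (\tr A).
Proof. by rewrite /adjmx mxtrace_tr trace_map_mx. Qed.

Lemma ReZ (a : R) (z : C) : complex.Re (a%:C * z) = a * complex.Re z.
Proof. by case: z => x y /=; rewrite mul0r subr0. Qed.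

Lemma Re_conj (z : C) : complex.Re (Num.conj z) = complex.Re z.
Proof. by case: z. Qed.

(** The real Hilbert-Schmidt inner product; between hermitian matrices it equals the trace
    pairing. *)
Definition rdot m n (X Y : 'M[C]_(m, n)) : R := complex.Re (\tr (X *m adjmx Y)).

Lemma rdotC m n (X Y : 'M[C]_(m, n)) : rdot X Y = rdot Y X.
Proof. by rewrite /rdot -Re_conj -mxtrace_adj adjmxM adjmxK. Qed.

Lemma rdotDl m n (X Y Z : 'M[C]_(m, n)) : rdot (X + Y) Z = rdot X Z + rdot Y Z.
Proof. by rewrite /rdot mulmxDl mxtraceD raddfD. Qed.

Lemma rdotNl m n (X Z : 'M[C]_(m, n)) : rdot (- X) Z = - rdot X Z.
Proof. by rewrite /rdot mulNmx raddfN/= raddfN. Qed.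

Lemma rdotZl m n (a : R) (X Z : 'M[C]_(m, n)) : rdot (a%:C *: X) Z = a * rdot X Z.
Proof. by rewrite /rdot -scalemxAl mxtraceZ ReZ. Qed.

Lemma rdotDr m n (X Y Z : 'M[C]_(m, n)) : rdot Z (X + Y) = rdot Z X + rdot Z Y.
Proof. by rewrite rdotC rdotDl !(rdotC Z). Qed.

Lemma rdotNr m n (X Z : 'M[C]_(m, n)) : rdot Z (- X) = - rdot Z X.
Proof. by rewrite rdotC rdotNl !(rdotC Z). Qed.

Lemma rdotZr m n (a : R) (X Z : 'M[C]_(m, n)) : rdot Z (a%:C *: X) = a * rdot Z X.
Proof. by rewrite rdotC rdotZl !(rdotC Z). Qed.

Definition rdotE := (rdotDl, rdotDr, rdotNl, rdotNr, rdotZl, rdotZr).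

Lemma rdot_sum m n (X Y : 'M[C]_(m, n)) :
  rdot X Y = \sum_i \sum_j (complex.Re (X i j) * complex.Re (Y i j)
                           + complex.Im (X i j) * complex.Im (Y i j)).
Proof.
rewrite /rdot /mxtrace raddf_sum; apply: eq_bigr => i _.
rewrite mxE raddf_sum; apply: eq_bigr => j _; rewrite adjmxE.
by case: (X i j) (Y i j) => a b [c d] /=; rewrite mulrN opprK.
Qed.

Lemma rdot_ge0 m n (X : 'M[C]_(m, n)) : 0 <= rdot X X.
Proof.
rewrite rdot_sum; apply: sumr_ge0 => i _; apply: sumr_ge0 => j _.
by rewrite addr_ge0 // -expr2 sqr_ge0.
Qed.

Lemma rdot_entry m n (X : 'M[C]_(m, n)) i j :
  complex.Re (X i j) ^+ 2 + complex.Im (X i j) ^+ 2 <= rdot X X.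
Proof.
have P a b : 0 <= complex.Re (X a b) * complex.Re (X a b) + complex.Im (X a b) * complex.Im (X a b).
  by rewrite addr_ge0 // -expr2 sqr_ge0.
rewrite rdot_sum (bigD1 i) //= (bigD1 j) //= !expr2 -addrA lerDl.
by rewrite addr_ge0 // ?sumr_ge0 // => *; rewrite sumr_ge0.
Qed.

Lemma rdot_eq0 m n (X : 'M[C]_(m, n)) : rdot X X = 0 -> X = 0.
Proof.
move=> X0; apply/matrixP => i j; rewrite mxE.
have := rdot_entry X i j; rewrite X0.
case: (X i j) => a b /= le0.
have a0 := sqr_ge0 a; have b0 := sqr_ge0 b.
have /eqP : a ^+ 2 = 0 by lra.
have /eqP : b ^+ 2 = 0 by lra.
by rewrite !sqrf_eq0 => /eqP -> /eqP ->.
Qed.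

Lemma rdot_gt0 m n (X : 'M[C]_(m, n)) : X != 0 -> 0 < rdot X X.
Proof.
by move=> X0; rewrite lt_def rdot_ge0 andbT; apply: contraNneq X0 => /rdot_eq0 ->.
Qed.

(** For [Y != 0], expand the squared norm of [(rdot Y Y) X - (rdot X Y) Y] and cancel one factor
    [rdot Y Y]. *)
Lemma rdot_CS m n (X Y : 'M[C]_(m, n)) : rdot X Y ^+ 2 <= rdot X X * rdot Y Y.
Proof.
have [->|Y0] := eqVneq Y 0.
  by rewrite -[0]addr0 -{1}(subrr 0) !rdotE; lra.
have yy := rdot_gt0 Y0.
have := rdot_ge0 ((rdot Y Y)%:C *: X - (rdot X Y)%:C *: Y).
rewrite !rdotE (rdotC Y X) => h.
have : 0 <= rdot Y Y * (rdot X X * rdot Y Y - rdot X Y ^+ 2) by nra.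
by rewrite pmulr_rge0 // subr_ge0.
Qed.

Lemma normr_rdot m n (X Y : 'M[C]_(m, n)) :
  `|rdot X Y| <= Num.sqrt (rdot X X) * Num.sqrt (rdot Y Y).
Proof.
rewrite -sqrtrM ?rdot_ge0 // -sqrtr_sqr ler_wsqrtr //; exact: rdot_CS.
Qed.

Lemma quadE n (v : 'cV[C]_n) (A : 'M[C]_n) : (adjmx v *m A *m v) 0 0 = \tr (v *m adjmx v *m A).
Proof. by rewrite -trace_mx11 mxtrace_mulC mulmxA. Qed.

Lemma cnormE n (v : 'cV[C]_n) : (adjmx v *m v) 0 0 = (rdot v v)%:C.
Proof.
rewrite -trace_mx11 mxtrace_mulC /rdot.
suff: complex.Im (\tr (v *m adjmx v)) = 0 by case: (\tr _) => a b /= ->.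
have : Num.conj (\tr (v *m adjmx v)) = \tr (v *m adjmx v) by rewrite -mxtrace_adj adjmxM adjmxK.
case: (\tr _) => a b /= [].
move=> ?; lra.
Qed.

Lemma hermitian_quad_real n (A : 'M[C]_n) (v : 'cV[C]_n) : Defs.hermitian A ->
  (adjmx v *m A *m v) 0 0 = (rdot (v *m adjmx v) A)%:C.
Proof.
move=> hA; rewrite quadE /rdot hA.
suff: complex.Im (\tr (v *m adjmx v *m A)) = 0 by case: (\tr _) => a b /= ->.
have : Num.conj (\tr (v *m adjmx v *m A)) = \tr (v *m adjmx v *m A).
  by rewrite -mxtrace_adj !adjmxM adjmxK hA mxtrace_mulC.
case: (\tr _) => a b /= [].
move=> ?; lra.
Qed.

(** Nonnegativity in the complex order includes being real, so the quadratic form of [S], the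
    antihermitian defect of [A], vanishes identically; polarisation then gives [S = 0]. *)
Lemma psd_hermitian n (A : 'M[C]_n) : psd A -> Defs.hermitian A.
Proof.
move=> pA.
pose S := adjmx A - A.
have S0 (v : 'cV[C]_n) : (adjmx v *m S *m v) 0 0 = 0.
  rewrite mulmxBr mulmxBl.
  have -> : adjmx v *m adjmx A *m v = adjmx (adjmx v *m A *m v).
    by rewrite !adjmxM adjmxK mulmxA.
  rewrite [LHS]mxE [X in _ + X]mxE adjmxE.
  move: (pA v); case: (_ 0 0) => a b; rewrite lecE /= => /andP[/eqP -> _].
  by apply/eqP; rewrite eq_complex /= oppr0 subrr addr0 eqxx.
suff: S = 0 by move/eqP; rewrite subr_eq0 => /eqP.
move: S S0 => S S0.
pose e (i : 'I_n) : 'cV[C]_n := delta_mx i 0.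
have eS i j : adjmx (e i) *m S *m e j = (S i j)%:M.
  apply/matrixP => a b; rewrite !ord1 /e /adjmx map_delta_mx trmx_delta.
  by rewrite -rowE -colE !mxE.
(* With a zero diagonal, [c = 1] gives [S i j + S j i = 0] and [c = 'i] gives [S i j = S j i]. *)
have S0' i j c : S i i + c * S i j + (Num.conj c * S j i + Num.conj c * (c * S j j)) = 0.
  have := S0 (e i + c *: e j).
  rewrite adjmxD adjmxZ !(mulmxDl, mulmxDr) -!scalemxAl -!scalemxAr !eS.
  by rewrite !mxE /= ?mulr1n addrACA.
have Sii i : S i i = 0 by have := S0' i i 0; rewrite conjC0 !mul0r !addr0.
apply/matrixP => i j; rewrite mxE.
have := S0' i j 1; have := S0' i j 'i%R; rewrite !Sii conjC1 !mulr0 !add0r !addr0 !mul1r.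
rewrite conjCi mulNr => /eqP; rewrite -mulrBr mulf_eq0 (negPf (@neq0Ci C)) /= subr_eq0 => /eqP <- /eqP.
by rewrite -mulr2n mulrn_eq0 /= => /eqP.
Qed.

End Adjoint.

(** * Ordered eigenvalues of hermitian matrices and their variational bounds *)

Section Eigenvalues.
Variable R : realType.
Local Notation C := (R[i]).

Lemma hermitian_diag n (A : 'M[C]_n) : Defs.hermitian A ->
  exists (U : 'M[C]_n) (d : 'I_n -> R),
    [/\ adjmx U *m U = 1%:M, U *m adjmx U = 1%:M
      & A = adjmx U *m diag_mx (\row_i (d i)%:C) *m U].
Proof.
move=> hA.
have hsym : A \is hermsymmx.
  by apply/is_hermitianmxP; rewrite expr0 scale1r -map_trmx; exact/esym/hA.
have /orthomx_spectralP eA := hermitian_normalmx hsym.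
have uU := spectral_unitarymx A.
have uV := invmx_unitary uU; rewrite -map_trmx -/(adjmx _) in uV.
have Uu := unitarymx_unit uU.
exists (spectralmx A), (fun i => complex.Re (spectral_diag A 0 i)); split.
- by rewrite -uV mulVmx.
- by rewrite -uV mulmxV.
rewrite [LHS]eA uV; congr (_ *m diag_mx _ *m _); apply/rowP => i; rewrite mxE.
have /mxOverP /(_ 0 i) := hermitian_spectral_diag_real hsym.
rewrite CrealE; case: (spectral_diag A 0 i) => a b /eqP /=.
by case=> ?; apply/eqP; rewrite eq_complex /= eqxx; apply/eqP; lra.
Qed.

Lemma char_poly_similar n (U V D : 'M[C]_n) : V *m U = 1%:M ->
  char_poly (V *m D *m U) = char_poly D.
Proof.
move=> VU; rewrite /char_poly /char_poly_mx.
have -> : 'X%:M - map_mx polyC (V *m D *m U)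
  = map_mx polyC V *m ('X%:M - map_mx polyC D) *m map_mx polyC U.
  rewrite mulmxBr mulmxBl !map_mxM; congr (_ - _).
  by rewrite scalar_mxC -mulmxA -map_mxM VU map_mx1 mulmx1.
rewrite !det_mulmx mulrAC -det_mulmx -map_mxM VU map_mx1 det1 mul1r //.
Qed.

(** [eigs] is a choice, so its specification holds only once a witness exists: the sorted diagonal.
    Unique factorisation of the characteristic polynomial then identifies the two multisets. *)
Lemma eigs_diag n (A U : 'M[C]_n) (d : 'I_n -> R) :
  adjmx U *m U = 1%:M -> A = adjmx U *m diag_mx (\row_i (d i)%:C) *m U ->
  [/\ sorted (fun x y : R => y <= x) (eigs A), size (eigs A) = n
    & perm_eq (eigs A) [seq d i | i <- enum 'I_n]].
Proof.
move=> UU eA.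
have cA : char_poly A = \prod_(x <- [seq d i | i <- enum 'I_n]) ('X - (x%:C)%:P).
  rewrite eA char_poly_similar // char_poly_trig ?diag_mx_is_trig // big_map big_enum.
  by apply: eq_bigr => i _; rewrite !mxE eqxx mulr1n.
have : is_sorted_eigs A (eigs A).
  apply: xgetPex; exists (sort (fun x y : R => y <= x) [seq d i | i <- enum 'I_n]).
  split; first by apply: sort_sorted => x y; exact: le_total.
  split; first by rewrite size_sort size_map size_enum_ord.
  by rewrite cA; apply/esym/perm_big; rewrite perm_sort.
case=> so [sz cp]; split=> //.
have inj : injective (real_complex R) by move=> x y [].
apply: (perm_map_inj inj); apply: prod_XsubC_eq.
by rewrite !(big_map (real_complex R) predT (fun x => 'X - x%:P)) -cp cA.
Qed.

Lemma quad_diag n (A U : 'M[C]_n) (d : 'I_n -> R) (v : 'cV[C]_n) :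
  A = adjmx U *m diag_mx (\row_i (d i)%:C) *m U ->
  rdot (v *m adjmx v) A =
  \sum_i d i * (complex.Re ((U *m v) i 0) ^+ 2 + complex.Im ((U *m v) i 0) ^+ 2).
Proof.
move=> eA; set c := U *m v.
have -> : rdot (v *m adjmx v) A = rdot (c *m adjmx c) (diag_mx (\row_i (d i)%:C)).
  rewrite /rdot eA /c !adjmxM adjmxK !mulmxA mxtrace_mulC.
  by rewrite !mulmxA.
rewrite rdot_sum; apply: eq_bigr => i _; rewrite (bigD1 i) //= big1 => [|j ji].
  rewrite !mxE big_ord1 !mxE eqxx mulr1n /=.
  by case: (\sum_j _) => a b /=; ring.
by rewrite !mxE eq_sym (negPf ji) mulr0n /= !mulr0 addr0.
Qed.

Lemma norm_unitary n m (U : 'M[C]_(m, n)) (v : 'cV[C]_n) : adjmx U *m U = 1%:M ->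
  rdot (U *m v) (U *m v) = rdot v v.
Proof.
move=> UU; apply: (@complexI R); rewrite -!cnormE adjmxM.
by rewrite -mulmxA (mulmxA (adjmx U)) UU mul1mx.
Qed.

Lemma rdot_col n (v : 'cV[C]_n) :
  rdot v v = \sum_i (complex.Re (v i 0) ^+ 2 + complex.Im (v i 0) ^+ 2).
Proof. by rewrite rdot_sum; apply: eq_bigr => i _; rewrite big_ord1 !expr2. Qed.

(** In an eigenbasis the form is a sum of eigenvalues with nonnegative weights of total [rdot v v],
    and each eigenvalue is at most the head of the sorted list. *)
Lemma quad_le_eigval0 n (A : 'M[C]_n) (v : 'cV[C]_n) : Defs.hermitian A ->
  rdot (v *m adjmx v) A <= eigval A 0 * rdot v v.
Proof.
move=> /hermitian_diag [U [d [UU _ eA]]].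
have [so sz pe] := eigs_diag UU eA.
rewrite (quad_diag _ eA) -(norm_unitary v UU) rdot_col mulr_sumr.
apply: ler_sum => i _; rewrite ler_wpM2r ?addr_ge0 ?sqr_ge0 //.
have : d i \in eigs A by rewrite (perm_mem pe) map_f // mem_enum.
rewrite /eigval; case: (eigs A) so => //= x s so; rewrite inE => /predU1P[-> //|].
have tr : transitive (fun x y : R => y <= x) by move=> a b c ab ca; exact: le_trans ca ab.
by move: (d i); apply/allP; exact: order_path_min so.
Qed.

Lemma ker_exists m n (M : 'M[C]_(m, n)) : (m < n)%N ->
  exists2 c : 'cV[C]_n, c != 0 & M *m c = 0.
Proof.
move=> mn; have : kermx M^T != 0.
  rewrite kermx_eq0 /row_free neq_ltn; apply/orP; left.
  by rewrite (leq_ltn_trans _ mn) // rank_leq_col.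
rewrite -nz_row_eq0 => h; exists (nz_row (kermx M^T))^T.
  by rewrite -[0]trmx0 (inj_eq trmx_inj).
apply: trmx_inj; rewrite trmx_mul trmxK trmx0.
by apply/sub_kermxP; exact: nz_row_sub.
Qed.

(* The eigenvectors for the [j + 1] largest eigenvalues span a space too big for
   [r <= j] linear conditions to meet only in [0]. *)
Lemma eigval_test n (A : 'M[C]_n) r j (M : 'M[C]_(r, n)) :
  Defs.hermitian A -> (r <= j < n)%N ->
  exists v : 'cV[C]_n, [/\ v != 0, M *m v = 0
    & eigval A j * rdot v v <= rdot (v *m adjmx v) A].
Proof.
move=> /hermitian_diag [U [d [UU UU' eA]]] /andP[rj jn].
have [so sz pe] := eigs_diag UU eA.
set l := eigval A j.
pose I := [set i | l <= d i]%SET.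
(* The first [j + 1] entries of the sorted list are all at least [l]; ties can only enlarge [I]. *)
have cI : (j < #|I|)%N.
  have -> : #|I| = count (fun x => l <= x) (eigs A).
    rewrite (permP pe) count_map -sum1_card -sum1_count big_enum_cond /=.
    by apply: eq_bigl => i; rewrite inE.
  have tr : transitive (fun x y : R => y <= x) by move=> a b c ab ca; exact: le_trans ca ab.
  rewrite -(cat_take_drop j.+1 (eigs A)) count_cat.
  have : all (fun x => l <= x) (take j.+1 (eigs A)).
    apply/(all_nthP 0) => i; rewrite size_takel ?sz // => ij.
    rewrite nth_take // /l /eigval.
    by apply: (sorted_leq_nth tr (@lexx _ R) 0 so); rewrite ?inE ?sz // (leq_trans ij).
  rewrite all_count size_takel ?sz // => /eqP ->.
  by rewrite ltn_addr.
(* [E] embeds the coordinates indexed by [I], so the vectors [adjmx U *m E *m c] are the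
   combinations of eigenvectors with eigenvalue at least [l]. The [r] conditions on more than [r]
   coefficients leave a nonzero [c]. *)
pose E : 'M[C]_(n, #|I|) := \matrix_(a, b) (a == enum_val b)%:R.
have [c c0 Mc] := @ker_exists _ _ (M *m adjmx U *m E) (leq_ltn_trans rj cI).
have UEc : U *m (adjmx U *m E *m c) = E *m c by rewrite !mulmxA UU' mul1mx.
exists (adjmx U *m E *m c); split.
- apply: contra_neq c0 => v0; move: UEc; rewrite v0 mulmx0 => /colP Ec.
  apply/colP => b; have := Ec (enum_val b).
  rewrite !mxE (bigD1 b) //= big1 => [|b' bb']; first by rewrite mxE eqxx mul1r addr0.
  by rewrite mxE (inj_eq enum_val_inj) eq_sym (negPf bb') mul0r.
- by rewrite -Mc !mulmxA.
rewrite (quad_diag _ eA) -(norm_unitary _ UU) rdot_col mulr_sumr UEc.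
apply: ler_sum => a _; have [aI|aI] := boolP (a \in I).
  by rewrite ler_wpM2r ?addr_ge0 ?sqr_ge0 //; move: aI; rewrite inE.
suff -> : (E *m c) a 0 = 0 by rewrite /= expr0n /= addr0 !mulr0.
rewrite mxE big1 // => b _; rewrite mxE; case: eqP => [ab|_]; last by rewrite mul0r.
by move: aI; rewrite ab enum_valP.
Qed.

End Eigenvalues.

(** * Rank-one operators and the partial trace *)

Section PartialTrace.
Variable R : realType.
Local Notation C := (R[i]).

Definition proj1d n (v : 'cV[C]_n) : 'M[C]_n := v *m adjmx v.

Lemma proj1d_herm n (v : 'cV[C]_n) : Defs.hermitian (proj1d v).
Proof. by rewrite /Defs.hermitian /proj1d adjmxM adjmxK. Qed.

Lemma tr_proj1d n (v : 'cV[C]_n) : \tr (proj1d v) = (rdot v v)%:C.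
Proof. by rewrite -cnormE -trace_mx11 mxtrace_mulC. Qed.

Lemma rdot_proj1d n (v : 'cV[C]_n) : rdot (proj1d v) (proj1d v) = rdot v v ^+ 2.
Proof.
have vv : adjmx v *m v = (rdot v v)%:C%:M by rewrite [LHS]mx11_scalar cnormE.
rewrite {1}/rdot proj1d_herm {2}/proj1d mulmxA -(mulmxA v) vv mul_mx_scalar -scalemxAl.
by rewrite mxtraceZ -/(proj1d v) tr_proj1d ReZ expr2.
Qed.

Lemma proj1dZ n (a : R) (v : 'cV[C]_n) : proj1d (a%:C *: v) = (a ^+ 2)%:C *: proj1d v.
Proof.
rewrite /proj1d adjmxZ -scalemxAl -scalemxAr scalerA; congr (_ *: _).
by apply/eqP; rewrite eq_complex /=; apply/andP; split; apply/eqP; ring.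
Qed.

Lemma rdot_herm n (X A : 'M[C]_n) : Defs.hermitian A -> rdot X A = complex.Re (\tr (X *m A)).
Proof. by rewrite /rdot => ->. Qed.

Lemma herm_tr_real n (X A : 'M[C]_n) : Defs.hermitian X -> Defs.hermitian A ->
  \tr (X *m A) = (rdot X A)%:C.
Proof.
move=> hX hA; rewrite (rdot_herm _ hA).
have : Num.conj (\tr (X *m A)) = \tr (X *m A).
  by rewrite -mxtrace_adj adjmxM hA hX mxtrace_mulC.
by case: (\tr _) => a b /= [] ?; apply/eqP; rewrite eq_complex /= eqxx; apply/eqP; lra.
Qed.

Variables (k n : nat).
Implicit Types (Y : 'M[C]_(k * n)) (A : 'M[C]_k) (u : 'cV[C]_(k * n)).

Lemma sum_tens (F : 'I_(k * n) -> C) :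
  \sum_a F a = \sum_i \sum_l F (mxtens_index (i, l)).
Proof.
rewrite pair_big /= (reindex (@mxtens_index k n)) /=.
  by apply: eq_bigr => -[].
by exists (@mxtens_unindex k n) => x _; rewrite ?mxtens_indexK ?mxtens_unindexK.
Qed.

Lemma ptrace2D Y Y' : ptrace2 (Y + Y') = ptrace2 Y + ptrace2 Y'.
Proof.
apply/matrixP => i j; rewrite !mxE -big_split /=.
by apply: eq_bigr => l _; rewrite mxE.
Qed.

Lemma ptrace2Z a Y : ptrace2 (a *: Y) = a *: ptrace2 Y.
Proof.
apply/matrixP => i j; rewrite !mxE mulr_sumr.
by apply: eq_bigr => l _; rewrite mxE.
Qed.

Lemma ptrace2_adj Y : ptrace2 (adjmx Y) = adjmx (ptrace2 Y).
Proof.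
apply/matrixP => i j; rewrite adjmxE !mxE rmorph_sum /=.
by apply: eq_bigr => l _; rewrite adjmxE.
Qed.

Lemma ptrace2_herm Y : Defs.hermitian Y -> Defs.hermitian (ptrace2 Y).
Proof. by rewrite /Defs.hermitian -ptrace2_adj => ->. Qed.

Lemma tr_ptrace2 Y : \tr (ptrace2 Y) = \tr Y.
Proof. by rewrite /mxtrace sum_tens; apply: eq_bigr => i _; rewrite mxE. Qed.

(** The partial trace is dual to [A |-> A *t 1]; this turns pairings of outputs with [A] into
    quadratic forms of the operator in the eigenvalue condition. *)
Lemma tr_ptrace2M Y A : \tr (ptrace2 Y *m A) = \tr (Y *m (A *t (1%:M : 'M[C]_n))).
Proof.
rewrite /mxtrace sum_tens; apply: eq_bigr => i _.
rewrite mxE; under eq_bigr do rewrite mxE mulr_suml.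
rewrite exchange_big; apply: eq_bigr => l _ /=.
rewrite mxE sum_tens; apply: eq_bigr => j _.
rewrite (bigD1 l) //= big1 => [|l' ll'].
  by rewrite tensmxE mxE eqxx mulr1 addr0.
by rewrite tensmxE mxE (negPf ll') !mulr0.
Qed.

Lemma tens1_herm A : Defs.hermitian A -> Defs.hermitian (A *t (1%:M : 'M[C]_n)).
Proof.
by move=> hA; rewrite /Defs.hermitian /adjmx map_mxT trmx_tens -!/(adjmx _) hA adjmx1.
Qed.

Lemma rdot_ptrace2 Y A : Defs.hermitian A ->
  rdot (ptrace2 Y) A = rdot Y (A *t (1%:M : 'M[C]_n)).
Proof. by move=> hA; rewrite !rdot_herm ?tr_ptrace2M //; apply: tens1_herm. Qed.

Definition slice u (l : 'I_n) : 'cV[C]_k := \col_i u (mxtens_index (i, l)) 0.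

(** Writing the partial trace as a sum of rank-one operators reduces its positivity and its norm
    bound to the rank-one case. *)
Lemma ptrace2_slice u : ptrace2 (proj1d u) = \sum_l proj1d (slice u l).
Proof.
apply/matrixP => i j; rewrite summxE mxE; apply: eq_bigr => l _.
by rewrite !mxE !big_ord1 !mxE.
Qed.

Lemma rdot_slice u : \sum_l rdot (slice u l) (slice u l) = rdot u u.
Proof.
apply: (@complexI R); rewrite -tr_proj1d -tr_ptrace2 ptrace2_slice rmorph_sum raddf_sum /=.
apply: eq_bigr => l _.
by rewrite tr_proj1d.
Qed.

Lemma rdot_suml (I : finType) p q (F : I -> 'M[C]_(p, q)) (X : 'M[C]_(p, q)) :
  rdot (\sum_i F i) X = \sum_i rdot (F i) X.
Proof. by rewrite /rdot mulmx_suml [\tr _]raddf_sum /= raddf_sum. Qed.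

Lemma rdot_proj1d_le m (v : 'cV[C]_m) (A : 'M[C]_m) :
  `|rdot (proj1d v) A| <= Num.sqrt (rdot A A) * rdot v v.
Proof.
apply: le_trans (normr_rdot _ _) _.
by rewrite rdot_proj1d sqrtr_sqr ger0_norm ?rdot_ge0 // mulrC.
Qed.

(** The rank-one bound is applied to each slice, and the squared norms of the slices add up to that
    of [u]. The constant is therefore independent of [n]. *)
Lemma rdot_ptrace2_le u A :
  `|rdot (ptrace2 (proj1d u)) A| <= Num.sqrt (rdot A A) * rdot u u.
Proof.
rewrite ptrace2_slice rdot_suml -rdot_slice mulr_sumr.
apply: le_trans (ler_norm_sum _ _ _) _; apply: ler_sum => l _.
exact: rdot_proj1d_le.
Qed.

Lemma psd_of_rdot m (A : 'M[C]_m) : Defs.hermitian A ->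
  (forall v : 'cV[C]_m, 0 <= rdot (proj1d v) A) -> psd A.
Proof. by move=> hA h v; rewrite hermitian_quad_real // lecR; exact: h. Qed.

Lemma psd_ptrace2 u : psd (ptrace2 (proj1d u)).
Proof.
apply: psd_of_rdot => [|v]; first exact/ptrace2_herm/proj1d_herm.
rewrite rdotC ptrace2_slice rdot_suml; apply: sumr_ge0 => l _; set w := slice u l.
have -> : rdot (proj1d w) (proj1d v) = rdot (adjmx v *m w) (adjmx v *m w).
  rewrite /rdot proj1d_herm adjmxM adjmxK /proj1d mulmxA mxtrace_mulC !mulmxA //.
exact: rdot_ge0.
Qed.

End PartialTrace.

(** * Outputs of pure states and the compression of [A *t 1] *)

Section Compression.
Variables (R : realType) (k n N : nat) (V : 'M[R[i]]_(k * n, N)).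
Local Notation C := (R[i]).
Hypothesis hV : adjmx V *m V = 1%:M.

Local Notation P := (V *m adjmx V).
(** The channel applied to the rank-one operator of [w]. It is left unnormalised, so that it is
    quadratic in [w] and has trace [rdot w w]. *)
Definition output (w : 'cV[C]_N) : 'M[C]_k := ptrace2 (proj1d (V *m w)).

Local Notation T A := (P *m (A *t (1%:M : 'M[C]_n)) *m P).

Lemma output_tr w : \tr (output w) = (rdot w w)%:C.
Proof. by rewrite tr_ptrace2 tr_proj1d norm_unitary. Qed.

Lemma output_herm w : Defs.hermitian (output w).
Proof. exact/ptrace2_herm/proj1d_herm. Qed.

Lemma outputZ (a : R) w : output (a%:C *: w) = (a ^+ 2)%:C *: output w.
Proof. by rewrite /output -scalemxAr proj1dZ ptrace2Z. Qed.

Lemma outputE w : output w = ptrace2 (V *m proj1d w *m adjmx V).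
Proof. by rewrite /output /proj1d adjmxM !mulmxA. Qed.

Lemma T_herm A : Defs.hermitian A -> Defs.hermitian (T A).
Proof.
move=> hA; rewrite /Defs.hermitian !adjmxM adjmxK.
by rewrite (tens1_herm _ hA) !mulmxA.
Qed.

Lemma quad_T A (v : 'cV[C]_(k * n)) : Defs.hermitian A ->
  rdot (proj1d v) (T A) = rdot (output (adjmx V *m v)) A.
Proof.
move=> hA; rewrite (rdot_herm _ (T_herm hA)) (rdot_ptrace2 _ hA).
rewrite (rdot_herm _ (tens1_herm _ hA)).
by rewrite !mulmxA mxtrace_mulC !mulmxA mxtrace_mulC /proj1d !adjmxM !adjmxK !mulmxA.
Qed.

Lemma output_le A (w : 'cV[C]_N) : Defs.hermitian A ->
  rdot (output w) A <= eigval (T A) 0 * rdot w w.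
Proof.
move=> hA; have -> : rdot (output w) A = rdot (proj1d (V *m w)) (T A).
  by rewrite quad_T //; congr (rdot (output _) A); rewrite mulmxA hV mul1mx.
by rewrite -(norm_unitary w hV); apply: quad_le_eigval0; exact: T_herm.
Qed.

(** Since [V *m adjmx V] is an orthogonal projection, the squared norm of [v] minus its projection
    is the difference of the two sides. *)
Lemma compress_norm (v : 'cV[C]_(k * n)) :
  rdot (adjmx V *m v) (adjmx V *m v) <= rdot v v.
Proof.
set w := adjmx V *m v.
have e : rdot (V *m w) v = rdot w w.
  by rewrite /rdot /w adjmxM adjmxK !mulmxA [in RHS]mxtrace_mulC !mulmxA.
have := rdot_ge0 (v - V *m w); rewrite !rdotE (rdotC v) e (norm_unitary w hV).
lra.
Qed.

(** A test vector [v] for the compression is replaced by [adjmx V *m v]. Positivity of the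
    eigenvalue keeps this vector nonzero, and lets the smaller norm of [adjmx V *m v] replace that
    of [v] in the bound. *)
Lemma output_test A r j (M : 'M[C]_(r, N)) : Defs.hermitian A -> (r <= j)%N ->
  0 < eigval (T A) j ->
  exists w : 'cV[C]_N, [/\ w != 0, M *m w = 0
    & eigval (T A) j * rdot w w <= rdot (output w) A].
Proof.
move=> hA rj lpos.
have hT := T_herm hA.
(* Beyond the end of the list [eigval] takes the default value [0], which [lpos] excludes. *)
have jn : (j < k * n)%N.
  have [U [d [UU _ eA]]] := hermitian_diag hT.
  have [_ sz _] := eigs_diag UU eA.
  rewrite ltnNge; apply/negP => nj; move: lpos.
  by rewrite /eigval nth_default ?ltxx // sz.
have [|v [v0 Mv le]] := @eigval_test _ _ (T A) r j (M *m adjmx V) hT; first by rewrite rj.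
rewrite -/(proj1d v) quad_T // in le.
exists (adjmx V *m v); split.
- apply: contra_neq v0 => w0; move: le; rewrite w0 /output mulmx0 /proj1d mul0mx.
  have -> : ptrace2 (0 : 'M[C]_(k * n)) = 0 by rewrite -[0](scale0r 0) ptrace2Z !scale0r.
  have -> : rdot 0 A = 0 by rewrite /rdot mul0mx mxtrace0.
  rewrite pmulr_rle0 // => h; apply: rdot_eq0; apply/eqP.
  by rewrite eq_le h rdot_ge0.
- by rewrite mulmxA.
apply: le_trans le; rewrite ler_wpM2l ?(ltW lpos) //; exact: compress_norm.
Qed.

(** Rank one gives [X = c *m r], and [X = X *m adjmx X] turns this into [s] times the rank-one
    operator of [c], where [s] is the squared norm of [r]. Idempotence forces the rescaled vector to
    have norm one. *)
Lemma pure_state_proj1d (X : 'M[C]_N) : pure_states N X ->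
  exists2 x : 'cV[C]_N, X = proj1d x & rdot x x = 1.
Proof.
case=> hX [XX rX].
have [c [r eX]] : exists (c : 'cV[C]_N) (r : 'rV[C]_N), X = c *m r.
  move: (col_base X) (row_base X) (mulmx_base X); rewrite rX => c r <-.
  by exists c, r.
pose s : R := rdot (adjmx r) (adjmx r).
have rr : r *m adjmx r = s%:C%:M.
  by rewrite [LHS]mx11_scalar -[in LHS](adjmxK r) adjmxK -cnormE adjmxK.
pose x := (Num.sqrt s)%:C *: c.
have Xx : X = proj1d x.
  rewrite proj1dZ sqr_sqrtr ?rdot_ge0 // -XX -{2}hX eX adjmxM mulmxA -(mulmxA c).
  by rewrite rr mul_mx_scalar -scalemxAl.
exists x => //; apply: (@complexI R); rewrite -tr_proj1d -Xx.
have : X != 0 by rewrite -mxrank_eq0 rX.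
rewrite Xx => x0; have x1 : x != 0.
  by apply: contraNneq x0 => ->; rewrite /proj1d mul0mx.
have : rdot (proj1d x) (proj1d x) = rdot x x.
  by rewrite {1}/rdot proj1d_herm -Xx XX Xx tr_proj1d.
rewrite rdot_proj1d expr2 -[RHS]mulr1 => /(mulfI (lt0r_neq0 (rdot_gt0 x1))) e.
by rewrite tr_proj1d e.
Qed.

Lemma proj1d_pure_state (x : 'cV[C]_N) : rdot x x = 1 -> pure_states N (proj1d x).
Proof.
move=> x1; split; first exact: proj1d_herm.
have tr : proj1d x *m proj1d x = proj1d x.
  rewrite /proj1d mulmxA -(mulmxA x) [adjmx x *m x]mx11_scalar cnormE x1.
  by rewrite mulmx1.
split=> //; apply/eqP; rewrite eqn_leq lt0n mxrank_eq0.
rewrite (leq_trans (mulmx_max_rank _ _)) //=; apply/eqP => x0.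
have := tr_proj1d x; rewrite x0 mxtrace0 x1 => /(congr1 (@complex.Re R)) /=.
by move/eqP; rewrite eq_sym oner_eq0.
Qed.

End Compression.

(** * Entrywise continuity of matrix-valued maps *)

Section Continuity.
Variables (R : realType) (T : topologicalType).
Local Notation C := (R[i]).

Definition mxcont m n (F : T -> 'M[C]_(m, n)) : Prop := forall i j,
  continuous (fun x => complex.Re (F x i j)) /\
  continuous (fun x => complex.Im (F x i j)).

Lemma continuous_bigsum (I : Type) (r : seq I) (F : I -> T -> R) :
  (forall i, continuous (F i)) -> continuous (fun x => \sum_(i <- r) F i x).
Proof.
move=> cF; elim: r => [|i r IH].
  by under eq_fun do rewrite big_nil; exact: cst_continuous.
under eq_fun do rewrite big_cons.
by move=> x; apply: cvgD; [exact: cF | exact: IH].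
Qed.

Lemma mxcont_cst m n (A : 'M[C]_(m, n)) : mxcont (fun=> A).
Proof. by move=> i j; split; exact: cst_continuous. Qed.

Lemma mxcontB m n (F G : T -> 'M[C]_(m, n)) :
  mxcont F -> mxcont G -> mxcont (fun x => F x - G x).
Proof.
move=> cF cG i j; have [fr fi] := cF i j; have [gr gi] := cG i j; split.
  have -> : (fun x => complex.Re ((F x - G x) i j)) =
      (fun x => complex.Re (F x i j) - complex.Re (G x i j)).
    by apply/funext => x; rewrite !mxE raddfB.
  by move=> x; apply: cvgB; [exact: fr | exact: gr].
have -> : (fun x => complex.Im ((F x - G x) i j)) =
    (fun x => complex.Im (F x i j) - complex.Im (G x i j)).
  by apply/funext => x; rewrite !mxE raddfB.
by move=> x; apply: cvgB; [exact: fi | exact: gi].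
Qed.

Lemma mxcont_adj m n (F : T -> 'M[C]_(m, n)) : mxcont F -> mxcont (fun x => adjmx (F x)).
Proof.
move=> cF i j; have [fr fi] := cF j i; split.
  have -> : (fun x => complex.Re (adjmx (F x) i j)) = (fun x => complex.Re (F x j i)).
    by apply/funext => x; rewrite adjmxE; case: (F x j i).
  exact: fr.
have -> : (fun x => complex.Im (adjmx (F x) i j)) = (fun x => - complex.Im (F x j i)).
  by apply/funext => x; rewrite adjmxE; case: (F x j i).
by move=> x; apply: cvgN; exact: fi.
Qed.

Lemma mxcontM m n p (F : T -> 'M[C]_(m, n)) (G : T -> 'M[C]_(n, p)) :
  mxcont F -> mxcont G -> mxcont (fun x => F x *m G x).
Proof.
move=> cF cG i j; split.
  have -> : (fun x => complex.Re ((F x *m G x) i j)) =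
      (fun x => \sum_l (complex.Re (F x i l) * complex.Re (G x l j) -
                        complex.Im (F x i l) * complex.Im (G x l j))).
    apply/funext => x; rewrite mxE raddf_sum; apply: eq_bigr => l _.
    by case: (F x i l) (G x l j) => a b [].
  apply: continuous_bigsum => l x; have [fr fi] := cF i l; have [gr gi] := cG l j.
  by apply: cvgB; apply: cvgM; [exact: fr | exact: gr | exact: fi | exact: gi].
have -> : (fun x => complex.Im ((F x *m G x) i j)) =
    (fun x => \sum_l (complex.Re (F x i l) * complex.Im (G x l j) +
                      complex.Im (F x i l) * complex.Re (G x l j))).
  apply/funext => x; rewrite mxE raddf_sum; apply: eq_bigr => l _.
  by case: (F x i l) (G x l j) => a b [].
apply: continuous_bigsum => l x; have [fr fi] := cF i l; have [gr gi] := cG l j.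
by apply: cvgD; apply: cvgM; [exact: fr | exact: gi | exact: fi | exact: gr].
Qed.

Lemma mxcont_ptrace2 k n (F : T -> 'M[C]_(k * n)) :
  mxcont F -> mxcont (fun x => ptrace2 (F x)).
Proof.
move=> cF i j; split.
  under eq_fun do rewrite mxE raddf_sum.
  by apply: continuous_bigsum => l; case: (cF (mxtens_index (i, l)) (mxtens_index (j, l))).
under eq_fun do rewrite mxE raddf_sum.
by apply: continuous_bigsum => l; case: (cF (mxtens_index (i, l)) (mxtens_index (j, l))).
Qed.

Lemma continuous_rdot m n (F G : T -> 'M[C]_(m, n)) :
  mxcont F -> mxcont G -> continuous (fun x => rdot (F x) (G x)).
Proof.
move=> cF cG; under eq_fun do rewrite rdot_sum.
apply: continuous_bigsum => i; apply: continuous_bigsum => j x.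
have [fr fi] := cF i j; have [gr gi] := cG i j.
by apply: cvgD; apply: cvgM; [exact: fr | exact: gr | exact: fi | exact: gi].
Qed.

End Continuity.

(** * Compactness of unit spheres and attained minima *)

Section Sphere.
Variable R : realType.
Local Notation C := (R[i]).

(** Real coordinates on complex matrices, the first half for real parts and the second for imaginary
    parts; compactness is then that of boxes of real row vectors. *)
Definition cplx m n (z : 'rV[R]_(m * n + m * n)) : 'M[C]_(m, n) :=
  \matrix_(i, j) (vec_mx (lsubmx z) i j +i* vec_mx (rsubmx z) i j).

Lemma cplx_surj m n (X : 'M[C]_(m, n)) : exists z, cplx z = X.
Proof.
exists (row_mx (mxvec (map_mx (@complex.Re R) X)) (mxvec (map_mx (@complex.Im R) X))).
by apply/matrixP => i j; rewrite mxE row_mxKl row_mxKr !mxvecK !mxE; case: (X i j).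
Qed.

Lemma mxcont_cplx m n : mxcont (@cplx m n).
Proof.
move=> i j; split.
  under eq_fun do rewrite !mxE /=; exact: coord_continuous.
under eq_fun do rewrite !mxE /=; exact: coord_continuous.
Qed.

Lemma sphere_compact m n :
  compact [set z : 'rV[R]_(m * n + m * n) | rdot (cplx z) (cplx z) = 1].
Proof.
have box := @rV_compact R (m * n + m * n) (fun=> `[-1, 1]%classic)
  (fun=> @segment_compact R (-1) 1).
apply: subclosed_compact box _.
  apply: (@preimage_closed _ _ (fun z => rdot (cplx z) (cplx z)) [set 1]).
    by move=> z _; exact: (continuous_rdot (@mxcont_cplx m n) (@mxcont_cplx m n)).
  exact: closed_eq.
move=> z /= z1 a; rewrite in_itv /= -ler_norml -(expr_le1 (n := 2)) // real_normK ?num_real //.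
rewrite -z1; case: (splitP a) => b ab.
  have -> : a = lshift _ b by exact: val_inj.
  case: (mxvec_indexP b) => i j.
  apply: le_trans (rdot_entry (cplx z) i j); rewrite !mxE /=.
  by rewrite lerDl sqr_ge0.
have -> : a = rshift _ b by exact: val_inj.
case: (mxvec_indexP b) => i j.
apply: le_trans (rdot_entry (cplx z) i j); rewrite !mxE /=.
by rewrite lerDr sqr_ge0.
Qed.

(** The extreme value theorem on the sphere; a nonzero matrix, once normalised, shows that the
    sphere is nonempty. *)
Lemma sphere_min m n (F : 'M[C]_(m, n) -> R) :
  continuous (fun z => F (@cplx m n z)) -> (exists X : 'M[C]_(m, n), X != 0) ->
  exists2 X0 : 'M[C]_(m, n), rdot X0 X0 = 1 & forall X, rdot X X = 1 -> F X0 <= F X.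
Proof.
move=> cF [X X0].
have [|c] := @compact_EVT_min _ R _ _ _ (@sphere_compact m n)
    (continuous_subspaceT cF).
  have pos := rdot_gt0 X0.
  have [z ez] := cplx_surj ((Num.sqrt (rdot X X))^-1%:C *: X).
  exists z => /=; rewrite ez !rdotE mulrA -expr2 exprVn sqr_sqrtr ?ltW // mulVf //.
  exact: lt0r_neq0.
rewrite inE /= => c1 cmin; exists (cplx c) => // Y.
by have [z <-] := cplx_surj Y => z1; apply: cmin; rewrite inE.
Qed.

End Sphere.

(** Here [a], [b], [c] stand for the squared norm of [D], the product of [D] and [E], and the
    squared norm of [E]. The last inequality says that [- D + t E] is no shorter than [D], which
    fails for [t = b / (c + 1)]. *)
Lemma descent_step (R : realFieldType) (a b c t : R) :
  0 < b -> 0 <= c -> 0 < t -> t * (c + 1) = b ->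
  a <= - (- a + t * b) + t * (- b + t * c) -> False.
Proof.
move=> b0 c0 t0 eb le.
have : 0 <= t * (t * c - 2 * b) by nra.
by rewrite pmulr_rge0 //; nra.
Qed.

(** * Moving an output closer to its target *)

Section Improvement.
Variables (R : realType) (k n N : nat) (V : 'M[R[i]]_(k * n, N)).
Local Notation C := (R[i]).
Hypothesis hV : adjmx V *m V = 1%:M.

(** The partial trace of [V w u^*] is linear in [w]; each of its [k * k] entries supplies one row of
    [M]. *)
Lemma cross_constraint (u : 'cV[C]_(k * n)) : exists M : 'M[C]_(k * k, N),
  forall w, M *m w = 0 -> ptrace2 (V *m w *m adjmx u) = 0.
Proof.
exists (\matrix_(p, a) \sum_l V (mxtens_index ((mxtens_unindex p).1, l)) a
   * adjmx u 0 (mxtens_index ((mxtens_unindex p).2, l))) => w /colP Mw.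
apply/matrixP => i j; have := Mw (mxtens_index (i, j)).
rewrite (mxE _ _ (mxtens_index (i, j)) 0) => e.
have {}e : _ = 0 := etrans e (mxE _ _ _ _).
rewrite [RHS]mxE -[RHS]e mxE.
under eq_bigr do rewrite mxE big_ord1 mxE mulr_suml.
rewrite exchange_big; apply: eq_bigr => a _.
rewrite mxE mulr_suml mxtens_indexK /=; apply: eq_bigr => l _.
by rewrite mulrAC.
Qed.

(** The two cross terms are adjoint to each other, so one condition removes both. *)
Lemma outputD (x w : 'cV[C]_N) (t : R) :
  ptrace2 (V *m w *m adjmx (V *m x)) = 0 ->
  output V (x + t%:C *: w) = output V x + (t ^+ 2)%:C *: output V w.
Proof.
move=> c0; have c0' : ptrace2 (V *m x *m adjmx (V *m w)) = 0.
  rewrite -[V *m x in LHS]adjmxK -adjmxM ptrace2_adj c0.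
  by apply/matrixP => i j; rewrite adjmxE !mxE conjC0.
rewrite -outputZ /output /proj1d mulmxDr adjmxD mulmxDl !mulmxDr !ptrace2D.
by rewrite -!scalemxAr adjmxZ -!scalemxAr -!scalemxAl !ptrace2Z c0 c0' !scaler0 addr0 add0r.
Qed.

Lemma output_min (B : 'M[C]_k) (x : 'cV[C]_N) :
  Defs.hermitian B -> \tr B = 1 -> rdot x x = 1 ->
  (forall y : 'cV[C]_N, rdot y y = 1 ->
     rdot (output V x - B) (output V x - B) <= rdot (output V y - B) (output V y - B)) ->
  (forall H : 'M[C]_k, Defs.hermitian H -> \tr H = 0 -> rdot H H = 1 ->
     forall M : 'M[C]_(k * k, N), exists w : 'cV[C]_N,
       [/\ w != 0, M *m w = 0 & rdot B H * rdot w w < rdot (output V w) H]) ->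
  output V x = B.
Proof.
move=> hB tB x1 xmin good.
have [D eD] : exists D, D = B - output V x by eexists.
have [/eqP|D0] := eqVneq D 0; first by rewrite eD subr_eq0 => /eqP.
have Dpos := rdot_gt0 D0; set s := Num.sqrt (rdot D D).
have spos : 0 < s by rewrite sqrtr_gt0.
have hD : Defs.hermitian D.
  by rewrite /Defs.hermitian eD adjmxD adjmxN hB output_herm.
have tD : \tr D = 0 by rewrite eD raddfB /= tB output_tr // x1 subrr.
have [M cM] := cross_constraint (V *m x).
have [|||w [w0 Mw lt]] := good (s^-1%:C *: D) _ _ _ M.
- rewrite /Defs.hermitian adjmxZ hD; congr (_ *: _).
  by apply/eqP; rewrite eq_complex /= oppr0 !eqxx.
- by rewrite mxtraceZ tD mulr0.
- by rewrite !rdotE mulrA -expr2 exprVn sqr_sqrtr ?(ltW Dpos) // mulVf // lt0r_neq0.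
have {}Mw := cM _ Mw.
(* Subtracting [B] with the weight [rdot w w] makes [E] traceless; the strict inequality from [good]
   becomes [0 < rdot D E]. *)
have [E eE] : exists E, E = output V w - (rdot w w)%:C *: B by eexists.
have DE : 0 < rdot D E.
  rewrite rdotC eE !rdotE subr_gt0 -(ltr_pM2l (x := s^-1)) ?invr_gt0 //.
  by move: lt; rewrite !rdotE (mulrC (rdot w w)) mulrA.
have EE := rdot_ge0 E.
(* The [+ 1] keeps the denominator positive even if [E = 0]. The vector moves by [Num.sqrt t]
   because outputs are quadratic. *)
have [t et] : exists t, t = rdot D E / (rdot E E + 1) by eexists.
have tpos : 0 < t by rewrite et divr_gt0 // ltr_wpDl.
pose z := x + (Num.sqrt t)%:C *: w.
have oz : output V z = output V x + t%:C *: output V w.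
  by rewrite outputD // sqr_sqrtr // ltW.
have nz : rdot z z = 1 + t * rdot w w.
  apply: (@complexI R); rewrite -(output_tr hV) oz raddfD /= mxtraceZ !output_tr // x1.
  by rewrite rmorphD rmorphM.
have ww : 0 < rdot w w by exact: rdot_gt0.
have nu1 : 1 <= rdot z z by rewrite nz lerDl mulr_ge0 // ltW.
have nu0 : 0 < rdot z z by exact: lt_le_trans ltr01 nu1.
set nu := rdot z z in nz nu1 nu0.
have := xmin ((Num.sqrt nu)^-1%:C *: z).
rewrite outputZ exprVn sqr_sqrtr ?(ltW nu0) // => /(_ _).
have eX : output V z - nu%:C *: B = - D + t%:C *: E.
  rewrite oz nz eD eE; apply/matrixP => i j; rewrite !mxE rmorphD rmorphM rmorph1 /=.
  by ring.
have -> : nu^-1%:C *: output V z - B = nu^-1%:C *: (- D + t%:C *: E).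
  have nuK : nu^-1%:C * nu%:C = 1 :> C by rewrite -rmorphM /= mulVf // lt0r_neq0.
  by rewrite -eX scalerBr scalerA nuK scale1r.
have -> : rdot (output V x - B) (output V x - B) = rdot D D.
  by rewrite -[output V x - B]opprB -eD !rdotE opprK.
have -> : rdot ((Num.sqrt nu)^-1%:C *: z) ((Num.sqrt nu)^-1%:C *: z) = 1.
  rewrite rdotZl rdotZr -/nu mulrA -expr2 exprVn sqr_sqrtr ?(ltW nu0) //.
  by rewrite mulVf ?lt0r_neq0.
move=> /(_ erefl); rewrite rdotZl rdotZr mulrA -expr2 exprVn ler_pdivlMl ?exprn_gt0 //.
rewrite !rdotE.
rewrite (rdotC E D).
have tE : t * (rdot E E + 1) = rdot D E.
  by rewrite et divfK // lt0r_neq0 // ltr_wpDl.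
rewrite ?(rdotC E D).
have h : rdot D D <= nu ^+ 2 * rdot D D by rewrite ler_peMl ?(ltW Dpos) // exprn_ege1.
move=> /(le_trans h); move: DE EE tpos tE.
by move=> b0 c0 t0 eb /(descent_step b0 c0 t0 eb).
Qed.

End Improvement.

(** * Density matrices near the maximally mixed state, and the set of directions *)

Section Density.
Variables (R : realType) (k : nat).
Local Notation C := (R[i]).

(** The maximally mixed state displaced along [H]; it turns a traceless direction into a density
    matrix, at which the limit [f] is available. *)
Definition shifted (H : 'M[C]_k) (tau : R) : 'M[C]_k :=
  (k%:R^-1)%:C *: (1%:M + tau%:C *: H).

Lemma herm_scale (H : 'M[C]_k) (a : R) : Defs.hermitian H -> Defs.hermitian (a%:C *: H).
Proof.
move=> hH; rewrite /Defs.hermitian adjmxZ hH; congr (_ *: _).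
by apply/eqP; rewrite eq_complex /= oppr0 !eqxx.
Qed.

Lemma shifted_herm H tau : Defs.hermitian H -> Defs.hermitian (shifted H tau).
Proof.
by move=> hH; apply: herm_scale; rewrite /Defs.hermitian adjmxD adjmx1 (herm_scale _ hH).
Qed.

Lemma rdot1 (X : 'M[C]_k) : rdot X 1%:M = complex.Re (\tr X).
Proof. by rewrite /rdot adjmx1 mulmx1. Qed.

Lemma rdot_shifted X H tau :
  rdot X (shifted H tau) = k%:R^-1 * (complex.Re (\tr X) + tau * rdot X H).
Proof. by rewrite /shifted !rdotE rdot1. Qed.

Lemma shifted_density H tau : (0 < k)%N -> Defs.hermitian H -> \tr H = 0 ->
  rdot H H <= 1 -> 0 <= tau <= 1 -> density k (shifted H tau).
Proof.
move=> k0 hH tH nH /andP[t0 t1]; have kR : (0 : R) < k%:R by rewrite ltr0n.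
split; last first.
  rewrite mxtraceZ mxtraceD mxtraceZ tH mulr0 addr0 mxtrace1.
  by rewrite -(rmorph_nat (real_complex R)) -rmorphM /= mulVf ?lt0r_neq0.
apply: psd_of_rdot => [|v]; first exact: shifted_herm.
rewrite rdot_shifted tr_proj1d /= mulr_ge0 ?invr_ge0 ?ler0n //.
have := rdot_proj1d_le v H; rewrite ler_norml => /andP[h _].
have vv := rdot_ge0 v.
have : Num.sqrt (rdot H H) * rdot v v <= rdot v v.
  by rewrite ler_piMl // -sqrtr1 ler_wsqrtr.
move: (rdot v v) (rdot (proj1d v) H) (Num.sqrt _ * _) h vv => a b c h a0 ca.
have ab : 0 <= a + b by lra.
(* A convex combination of the nonnegative numbers [a] and [a + b]. *)
have -> : a + tau * b = (1 - tau) * a + tau * (a + b) by ring.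
by rewrite addr_ge0 // mulr_ge0 // subr_ge0.
Qed.

Lemma normc_entry (H : 'M[C]_k) i j (eps : R) : 0 <= eps -> rdot H H = 1 ->
  `|(eps%:C *: H) i j| <= eps%:C.
Proof.
move=> e0 H1; rewrite mxE normrM.
have -> : `|eps%:C| = eps%:C by rewrite ger0_norm // lecR.
apply: ler_piMr; first by rewrite lecR.
have := rdot_entry H i j; rewrite H1 normc_def => h.
by rewrite (_ : 1 = 1%:C) // lecR -sqrtr1 ler_wsqrtr.
Qed.

Lemma unit_directions_compact :
  compact [set z | [/\ rdot (@cplx R k k z) (cplx z) = 1, Defs.hermitian (cplx z)
                     & \tr (cplx z) = 0]].
Proof.
have cc := @mxcont_cplx R k k.
apply: subclosed_compact (@sphere_compact R k k) _; last by move=> z [].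
have -> : [set z | [/\ rdot (@cplx R k k z) (cplx z) = 1, Defs.hermitian (cplx z)
                     & \tr (cplx z) = 0]] =
  ((fun z => rdot (@cplx R k k z) (cplx z)) @^-1` [set 1]) `&`
  (((fun z => rdot (cplx z - adjmx (@cplx R k k z)) (cplx z - adjmx (cplx z))) @^-1` [set 0])
  `&` ((fun z => rdot (@cplx R k k z) 1%:M) @^-1` [set 0])).
  apply/seteqP; split => z /=.
    move=> [-> hz tz]; split=> //; split; last by rewrite rdot1 tz.
    by rewrite hz subrr /rdot mul0mx mxtrace0.
  move=> [-> [/rdot_eq0/eqP]]; rewrite subr_eq0 => /eqP hz t0.
  have hz' : Defs.hermitian (cplx z) by exact/esym.
  (* The product with [1%:M] sees only the real part of the trace, but the trace of a hermitian
     matrix is real. *)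
  split=> //; rewrite -[cplx z]mulmx1 (herm_tr_real hz' (adjmx1 _ _)) t0 //.
apply: closedI; [|apply: closedI].
- apply: preimage_closed (@closed_eq _ _); move=> z _; exact: continuous_rdot.
- apply: preimage_closed (@closed_eq _ _); move=> z _.
  by apply: continuous_rdot; apply: mxcontB => //; exact: mxcont_adj.
- apply: preimage_closed (@closed_eq _ _); move=> z _.
  by apply: continuous_rdot => //; exact: mxcont_cst.
Qed.

End Density.

(** Replacing a direction by one within [eta] costs at most [eta * (1 + b) * x], a quarter of
    [e * x], while the available gain is half of [e * x]. *)
Lemma margin_bound (R : realFieldType) (x p q r beta e eta b : R) :
  (beta + e / 2) * x <= p -> - eta * x <= q -> r <= b * eta ->
  eta * (1 + b) = e / 4 -> 0 < x -> 0 < e -> (r + beta) * x < q + p.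
Proof.
move=> h1 h2 h3 et x0 e0.
have : r * x <= b * eta * x by rewrite ler_wpM2r // ltW.
have : eta * x + b * eta * x = e / 4 * x by rewrite -et; ring.
have : 0 < e * x by rewrite mulr_gt0.
move: h1; rewrite !mulrDl mulNr in h2 *; lra.
Qed.

Lemma margin_pos (R : realFieldType) (tau b beta e : R) :
  tau * (1 + b) = 1 -> 0 < tau -> - b <= beta -> 0 < e ->
  0 < 1 + tau * (beta + e / 2).
Proof.
move=> tb t0 bb e0; have : 0 < tau * (1 + b + (beta + e / 2)) by rewrite mulr_gt0 //; lra.
by rewrite mulrDr tb.
Qed.

(** * The two inclusions, with [n] uniform over all directions *)

Section Main.
Variables (R : realType) (k : nat) (N : nat -> nat).
Local Notation C := (R[i]).
Variable V : forall n : nat, 'M[C]_(k * n, N n).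
Hypothesis hV : forall n, adjmx (V n) *m V n = 1%:M.
Variables (f : 'M[C]_k -> R) (m : nat).
Hypothesis hC : cond_C (fun n => V n *m adjmx (V n)) m f.

Definition limit_body := [set B | density k B /\
                    forall A, density k A -> \tr (B *m A) <= (f A)%:C].
Definition pure_outputs n := [set ptrace2 (V n *m X *m adjmx (V n)) | X in pure_states (N n)].

Lemma K_rdot B A : limit_body B -> density k A -> rdot B A <= f A.
Proof.
move=> [[/psd_hermitian hB _] KB] dA; have hA := psd_hermitian dA.1.
by have := KB _ dA; rewrite herm_tr_real // lecR.
Qed.

Lemma limsup_sub : (0 < m)%N -> set_limsup pure_outputs `<=` limit_body.
Proof.
move=> m0 B LB.
have BE n : pure_outputs n B -> exists2 w : 'cV_(N n), B = output (V n) w & rdot w w = 1.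
  case=> X /pure_state_proj1d [w -> w1] <-; exists w => //.
  by rewrite outputE.
have dB : density k B.
  have [n _ /BE [w -> w1]] := LB 0%N I.
  by split; [exact: psd_ptrace2 | rewrite output_tr // w1].
split=> // A dA; have hA := psd_hermitian dA.1.
rewrite (herm_tr_real (psd_hermitian dB.1) hA) lecR leNgt; apply/negP => lt.
(* If the pairing with [A] exceeded [f A], it would eventually exceed the largest eigenvalue,
   although [B] is an output for arbitrarily large [n]. *)
have [n0 _ h] := cvgr_lt _ (hC dA m0) _ lt.
have [n n0n /BE [w eB w1]] := LB n0 I.
have := h n n0n; rewrite /= eB ltNge => /negP; apply.
by have := output_le (hV n) w hA; rewrite w1 mulr1.
Qed.

Lemma liminf_sub_limsup (T : Type) (S : nat -> set T) : set_liminf S `<=` set_limsup S.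
Proof.
move=> B [N0 _ h] N1 _; exists (maxn N0 N1); first by rewrite /= leq_maxr.
by apply: h; rewrite /= leq_maxl.
Qed.

(** Minimising over unit vectors requires [N n > 0]. At the maximally mixed state [f] is at least
    [1 / k], so the largest eigenvalue is eventually positive and [output_test], with no linear
    conditions, yields a vector. *)
Lemma eventually_nonzero B : (0 < k)%N -> (0 < m)%N -> limit_body B ->
  \forall n \near \oo, exists w : 'cV[C]_(N n), w != 0.
Proof.
move=> k0 m0 KB; have kR : (0 : R) < k%:R by rewrite ltr0n.
have dA : density k (shifted (0 : 'M[C]_k) 0).
  apply: shifted_density; rewrite ?mxtrace0 ?lexx ?ler01 //.
    by rewrite /Defs.hermitian /adjmx map_mx0 trmx0.
  by rewrite /rdot mul0mx mxtrace0 ler01.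
have fA : 0 < f (shifted 0 0).
  apply: lt_le_trans (K_rdot KB dA).
  by rewrite rdot_shifted KB.1.2 mul0r addr0 mulr1 invr_gt0.
apply: (filterS _ (cvgr_gt _ (hC dA m0) _ fA)) => n lpos.
have [w [w0 _ _]] := output_test (hV n) (0 : 'M[C]_(0, N n)) (psd_hermitian dA.1) (leqnn 0) lpos.
by exists w.
Qed.

(** The bound [k * k < m] is asked only for [1 < k]: truncated subtraction gives [m = 1] in the
    theorem when [k = 1], and then there is no unit traceless direction. *)
Lemma uniform_test B : (0 < k)%N -> ((1 < k)%N -> (k * k < m)%N) -> rel_interior limit_body B ->
  \forall n \near \oo, forall H : 'M[C]_k, Defs.hermitian H -> \tr H = 0 -> rdot H H = 1 ->
     forall M : 'M[C]_(k * k, N n), exists w : 'cV[C]_(N n),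
       [/\ w != 0, M *m w = 0 & rdot B H * rdot w w < rdot (output (V n) w) H].
Proof.
move=> k0 km [KB [eps [eps0 intB]]].
have hB := psd_hermitian KB.1.1; have tB : \tr B = 1 := KB.1.2.
have kR : (0 : R) < k%:R by rewrite ltr0n.
pose b := Num.sqrt (rdot B B); have b0 : 0 <= b by exact: sqrtr_ge0.
pose Pr n (z : 'rV[R]_(k * k + k * k)) := forall M : 'M[C]_(k * k, N n),
  exists w : 'cV[C]_(N n),
    [/\ w != 0, M *m w = 0 & rdot B (cplx z) * rdot w w < rdot (output (V n) w) (cplx z)].
suff : \forall n \near \oo, [set z | [/\ rdot (@cplx R k k z) (cplx z) = 1,
    Defs.hermitian (cplx z) & \tr (cplx z) = 0]] `<=` Pr n.
  apply: filterS => n h H hH tH nH.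
  by have [z ez] := cplx_surj H; move: (h z); rewrite /Pr /= ez; apply.
(* By compactness it suffices to treat all directions near a given [z0] together with all large
   [n]. *)
have /compact_near_coveringP cov := @unit_directions_compact R k.
apply: cov => z0 [n0 h0 t0]; set H0 := cplx z0 in n0 h0 t0.
have kk : (k * k < m)%N.
  apply: km; rewrite ltn_neqAle k0 andbT; apply/eqP => k1.
  have : H0 = 0; last by move=> e; move: n0; rewrite e /rdot mul0mx mxtrace0 => /eqP; rewrite eq_sym oner_eq0.
  clear -t0 k1; move: (H0) t0 => {H0} H; move: H; rewrite -k1 => H.
  by rewrite [H]mx11_scalar mxtrace_scalar mulr1n => ->; apply/matrixP => i j; rewrite !mxE mul0rn.
(* As [beta] is at least [- b], this choice makes the threshold [c] positive, and [tau <= 1] keeps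
   [A] a density matrix. *)
pose tau := (1 + b)^-1.
have tau0 : 0 < tau by rewrite invr_gt0 ltr_pwDl.
have tau1 : tau <= 1 by rewrite invf_le1 ?lerDl // ltr_pwDl.
have tb : tau * (1 + b) = 1 by rewrite mulVf // lt0r_neq0 // ltr_pwDl.
pose e := eps / 2; have e0 : 0 < e by rewrite divr_gt0.
have KB' : limit_body (B + e%:C *: H0).
  apply: intB.
  - by rewrite /Defs.hermitian adjmxD hB (herm_scale _ h0).
  - by rewrite mxtraceD mxtraceZ t0 mulr0 addr0.
  - move=> i j; rewrite mxE (addrC (B i j)) addrK.
    apply: le_lt_trans (normc_entry i j (ltW e0) n0) _.
    by rewrite ltcR /e; lra.
pose A := shifted H0 tau.
have hA : Defs.hermitian A by exact: shifted_herm.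
have dA : density k A by apply: shifted_density; rewrite ?n0 ?(ltW tau0).
pose beta := rdot B H0.
have betab : - b <= beta.
  by have := normr_rdot B H0; rewrite n0 sqrtr1 mulr1 ler_norml => /andP[].
(* The pairing of [A] with [B + (e / 2) H0]. It lies strictly below that with [B + e H0], hence
   below [f A], and the remaining [e / 2] is the gain over [B]. *)
pose c := k%:R^-1 * (1 + tau * (beta + e / 2)).
have c0 : 0 < c.
  rewrite mulr_gt0 ?invr_gt0 //; exact: (margin_pos tb tau0 betab e0).
have cf : c < f A.
  apply: lt_le_trans (K_rdot KB' dA).
  rewrite rdot_shifted mxtraceD mxtraceZ t0 mulr0 addr0 tB /= rdotDl rdotZl n0 mulr1.
  by rewrite ltr_pM2l ?invr_gt0 // ltrD2l ltr_pM2l // ltrD2l; lra.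
pose eta := tau * e / 4.
have eta0 : 0 < eta by rewrite /eta !mulr_gt0.
(* Eigenvalues are counted from [0], so index [k * k] is the last of the [k * k + 1] largest and
   allows for the [k * k] rows of [M]. *)
exists ([set z | rdot (cplx z - H0) (cplx z - H0) < eta ^+ 2],
        [set n | c < eigval (V n *m adjmx (V n) *m (A *t (1%:M : 'M[C]_n)) *m (V n *m adjmx (V n))) (k * k)]).
  split; last exact: cvgr_gt _ (hC dA kk) _ cf.
  have ct : continuous (fun z => rdot (@cplx R k k z - H0) (cplx z - H0)).
    by apply: continuous_rdot; apply: mxcontB; [exact: mxcont_cplx|exact: mxcont_cst|exact: mxcont_cplx|exact: mxcont_cst].
  apply: (cvgr_lt _ (ct z0)); rewrite -/H0 subrr /rdot mul0mx mxtrace0.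
  by rewrite exprn_gt0.
move=> [z n] /= [dz cn] M.
have lpos := lt_trans c0 cn.
have [w [w0 Mw le]] := output_test (hV n) M hA (leqnn _) lpos.
exists w; split=> //.
have ww := rdot_gt0 w0.
have sq : Num.sqrt (rdot (cplx z - H0) (cplx z - H0)) <= eta.
  by rewrite -[leRHS]ger0_norm ?(ltW eta0) // -sqrtr_sqr ler_wsqrtr // ltW.
have h1 : beta + e / 2 <= rdot (output (V n) w) H0 / rdot w w.
  rewrite ler_pdivlMr //.
  have : c * rdot w w <= rdot (output (V n) w) A.
    by apply: le_trans le; rewrite ler_wpM2r // ltW.
  rewrite rdot_shifted output_tr //= /c -mulrA ler_pM2l ?invr_gt0 //.
  by rewrite mulrDl mul1r lerD2l -mulrA ler_pM2l.
have h2 : - eta * rdot w w <= rdot (output (V n) w) (cplx z - H0).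
  have := rdot_ptrace2_le (V n *m w) (cplx z - H0); rewrite norm_unitary // ler_norml.
  case/andP=> h _; apply: le_trans h; rewrite mulNr lerN2.
  by rewrite ler_wpM2r // ltW.
have h3 : rdot B (cplx z - H0) <= b * eta.
  have := normr_rdot B (cplx z - H0); rewrite ler_norml => /andP[_ h].
  by apply: le_trans h _; rewrite ler_wpM2l.
rewrite -(subrK H0 (cplx z)) !(rdotDr _ H0) -/beta.
have et : eta * (1 + b) = e / 4.
  have -> : eta * (1 + b) = tau * (1 + b) * (e / 4) by rewrite /eta; ring.
  by rewrite tb mul1r.
move: h1; rewrite ler_pdivlMr //.
move=> h1; apply: (margin_bound h1 h2 h3 et ww e0).
Qed.

Lemma interior_sub : ((1 < k)%N -> (k * k < m)%N) -> (0 < m)%N ->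
  rel_interior limit_body `<=` set_liminf pure_outputs.
Proof.
move=> km m0 B iB; have KB := iB.1.
have hB := psd_hermitian KB.1.1; have tB : \tr B = 1 := KB.1.2.
have k0 : (0 < k)%N.
  case: (posnP k) => // k0; have := tB; rewrite /mxtrace big1 => [/eqP|i _].
    by rewrite eq_sym oner_eq0.
  by have := leq_ltn_trans (leq0n i) (ltn_ord i); rewrite [X in (_ < X)%N]k0.
have [N0 _ h] : \forall n \near \oo, pure_outputs n B; last by exists N0.
apply: (filterS _ (filterI (eventually_nonzero k0 m0 KB) (uniform_test k0 km iB))) => n [ne good].
have [|x x1 xmin] := @sphere_min R (N n) 1
  (fun x => rdot (output (V n) x - B) (output (V n) x - B)) _ ne.
  have cc := @mxcont_cplx R (N n) 1.
  have co : mxcont (fun z => output (V n) (@cplx R (N n) 1 z)).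
    apply: mxcont_ptrace2; apply: mxcontM; last apply: mxcont_adj;
      by apply: mxcontM => //; exact: mxcont_cst.
  by apply: continuous_rdot; apply: mxcontB => //; exact: mxcont_cst.
exists (proj1d x); first exact: proj1d_pure_state.
by rewrite -outputE; exact: output_min good.
Qed.

End Main.

Theorem theorem3p9 (R : realType) (k : nat) (N : nat -> nat)
  (V : forall n : nat, 'M[R[i]]_(k * n, N n))
  (hV : forall n, adjmx (V n) *m V n = 1%:M)
  (f : 'M[R[i]]_k -> R)
  (hC : cond_C (fun n => V n *m adjmx (V n)) ((2 * k ^ 2 - 3) * k ^ 2 + 1) f) :
  let K := [set B | density k B /\
                    forall A, density k A -> \tr (B *m A) <= (f A)%:C] in
  let L := fun n => [set ptrace2 (V n *m X *m adjmx (V n)) | X in pure_states (N n)] in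
  rel_interior K `<=` set_liminf L /\
  set_liminf L `<=` set_limsup L /\
  set_limsup L `<=` K.
Proof.
move=> K L.
have m0 : (0 < (2 * k ^ 2 - 3) * k ^ 2 + 1)%N by rewrite addn1.
split; last split; [|exact: liminf_sub_limsup|exact: (@limsup_sub _ _ _ _ hV _ _ hC m0)].
apply: (@interior_sub _ _ _ _ hV _ _ hC _ m0) => k1.
(* For [1 < k] the factor [2 * k ^ 2 - 3] is positive, hence the product is at least [k ^ 2]. *)
rewrite addn1 ltnS mulnn leq_pmull // subn_gt0.
by apply: (@leq_trans (2 * 2 ^ 2)); rewrite // leq_mul2l leq_exp2r.
Qed.
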